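(* Let $k,t$ be integers with $1\le t\le k$, let $s_1,\dots,s_k$ be positive integers, let $G=\mathbb{Z}_{s_1}\times\mathbb{Z}_{s_2}\times\cdots\times\mathbb{Z}_{s_k}$, and let $A$ be a nonempty finite multiset of elements of $G$ (the rows of $A$). Then $A$ is an $\mathrm{OA}(|A|,s_1s_2\cdots s_k,t)$ over $G$ if and only if $$\sum_{\mathbf x\in A}\chi_{\mathbf m}(\mathbf x)=0$$ for all nonzero elements $\mathbf m\in G$ with $|\operatorname{supp}(\mathbf m)|\le t$, where the sum runs over the rows of $A$ counted with multiplicity.
   Context: For a positive integer $s$, $\mathbb{Z}_s=\{0,1,\dots,s-1\}$ is the additive group modulo $s$. For $I=\{i_1,\dots,i_t\}\subseteq\{1,\dots,k\}$ let $G_I=\mathbb{Z}_{s_{i_1}}\times\cdots\times\mathbb{Z}_{s_{i_t}}$ and let $\pi_I:G\to G_I$ be the coordinate projection. A finite multiset $A$ of elements of $G$, of cardinality $|A|$ counted with multiplicity, is an orthogonal array of strength $t$ over $G$, denoted $\mathrm{OA}(|A|,s_1s_2\cdots s_k,t)$ (here $s_1s_2\cdots s_k$ is the list of numbers of levels, not a product), if for every $I\subseteq\{1,\dots,k\}$ with $|I|=t$ there is a positive integer $\lambda_I$ such that $|\{\alpha\in A:\pi_I(\alpha)=\beta\}|=\lambda_I$ for all $\beta\in G_I$ (counted with multiplicity). For $\mathbf m=(m_1,\dots,m_k)\in G$, $\chi_{\mathbf m}:G\to\mathbb{C}^*$ is the character $\chi_{\mathbf m}(\mathbf x)=\prod_{j=1}^k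 e^{2\pi i m_jx_j/s_j}$, and $\operatorname{supp}(\mathbf m)=\{j:m_j\neq0\}$. *)

(* Defs.v *)
From HB Require Import structures.
From mathcomp Require Import all_boot all_order all_algebra.
From mathcomp Require Import finmap multiset complex.
From mathcomp Require Import reals sequences exp trigo.

Set Implicit Arguments.
Unset Strict Implicit.
Unset Printing Implicit Defensive.

Import GRing.Theory.

Local Open Scope ring_scope.
Local Open Scope complex_scope.

(* The canonical additive group on ['I_n.+1] is addition modulo n.+1, so for
   s > 0 this is the group Z_s.  ('Z_s would give Z/2 for s = 1.)
   The value at s = 0 is junk. *)
Definition cyc (s : nat) := 'I_(s.-1.+1).
HB.instance Definition _ s := Finite.on (cyc s).
HB.instance Definition _ s := GRing.Zmodule.on (cyc s).

(* The direct product over a finite index type of the groups Z_(s i);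
   used with I = 'I_k for G, and with I a subset of 'I_k for G_I. *)
Definition prodZ (I : finType) (s : I -> nat) := {dffun forall i : I, cyc (s i)}.

Section ProdZGroup.
Variables (I : finType) (s : I -> nat).
Implicit Types x y z : prodZ s.

HB.instance Definition _ := Finite.on (prodZ s).

Definition prodZ_zero : prodZ s := [ffun i => 0 : cyc (s i)].
Definition prodZ_opp x : prodZ s := [ffun i => - x i : cyc (s i)].
Definition prodZ_add x y : prodZ s := [ffun i => x i + y i : cyc (s i)].

Fact prodZ_addA : associative prodZ_add.
Proof. by move=> x y z; apply/ffunP=> i; rewrite !ffunE addrA. Qed.
Fact prodZ_addC : commutative prodZ_add.
Proof. by move=> x y; apply/ffunP=> i; rewrite !ffunE addrC. Qed.
Fact prodZ_add0 : left_id prodZ_zero prodZ_add.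
Proof. by move=> x; apply/ffunP=> i; rewrite !ffunE add0r. Qed.
Fact prodZ_addN : left_inverse prodZ_zero prodZ_opp prodZ_add.
Proof. by move=> x; apply/ffunP=> i; rewrite !ffunE addNr. Qed.

HB.instance Definition _ := GRing.isZmodule.Build (prodZ s)
  prodZ_addA prodZ_addC prodZ_add0 prodZ_addN.
End ProdZGroup.

Section OrthogonalArrays.
Variables (k : nat) (s : 'I_k -> nat).

Definition restr_levels (I : {set 'I_k}) (i : {j : 'I_k | j \in I}) : nat :=
  s (val i).

Definition proj (I : {set 'I_k}) (x : prodZ s) : prodZ (@restr_levels I) :=
  [ffun i => x (val i)].

Definition is_OA (N t : nat) (A : {mset prodZ s}%mset) : Prop :=
  size A = N /\
  forall I : {set 'I_k}, #|I| = t ->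
    exists2 lambda : nat, (0 < lambda)%N &
      forall b : prodZ (@restr_levels I),
        count (fun a => proj I a == b) A = lambda.

Definition supp (m : prodZ s) : {set 'I_k} := [set j | m j != 0].

End OrthogonalArrays.

Section Characters.
Variable R : realType.

(* e^(a + ib) = e^a (cos b + i sin b) *)
Definition cexp (z : R[i]) : R[i] :=
  (expR (complex.Re z))%:C * (cos (complex.Im z) +i* sin (complex.Im z)).

Definition chi (k : nat) (s : 'I_k -> nat) (m x : prodZ s) : R[i] :=
  \prod_(j < k)
    cexp (2 * pi%:C * 'i%C * (val (m j))%:R * (val (x j))%:R / (s j)%:R).

End Characters.

(* Main.v *)
Require Import Defs.
From mathcomp Require Import all_boot all_order all_algebra.
From mathcomp Require Import finmap multiset complex.
From mathcomp Require Import reals.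
From mathcomp Require Import exp trigo ring.

(** Sums over rows of a function of [proj I x] are sums over [G_I] weighted by
    the multiplicities [c_I b] of the elements [b].  If [c_I] is constant, a
    nontrivial character of [G] supported in [I] sums to zero by orthogonality
    on [G_I].  Conversely, Fourier inversion on [G_I] writes [#|G_I| * c_I b] as
    a combination of the sums over [A] of the characters supported in [I]; only
    the trivial one survives, so [#|G_I| * c_I b = #|A|] for every [b]. *)

Section RootsOfUnity.
Local Open Scope ring_scope.
Local Open Scope complex_scope.
Import GRing.Theory Num.Theory Order.TTheory.
Variable R : realType.

Lemma cexp0 : cexp (0 : R[i]) = 1.
Proof. by rewrite /cexp /= expR0 cos0 sin0 mul1r. Qed.

Lemma cexpD (z w : R[i]) : cexp (z + w) = cexp z * cexp w.
Proof.
case: z w => [a b] [c d]; rewrite /cexp /= expRD cosD sinD.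
rewrite mulrACA -rmorphM; congr (_ * _).
by apply/eqP; rewrite eq_complex /= addrC eqxx [X in _ == X]addrC eqxx.
Qed.

Lemma cexpMn (z : R[i]) n : cexp (z *+ n) = cexp z ^+ n.
Proof. by elim: n => [|n IHn]; rewrite ?cexp0 // mulrS cexpD IHn exprS. Qed.

Definition zroot (n : nat) : R[i] := cexp (2 * pi%:C * 'i%C / n%:R).

(** Bringing the exponent to the form [0 +i* b] with [b] real reduces powers of [zroot n] to real
    trigonometry through [cexp_im]. *)
Lemma zroot_argMn (n k : nat) :
  2 * pi%:C * 'i%C / n%:R *+ k = 0 +i* (pi *+ 2 * (k%:R / n%:R)) :> R[i].
Proof.
have -> : (0 +i* (pi *+ 2 * (k%:R / n%:R)) : R[i])
    = (pi *+ 2 * (k%:R / n%:R))%:C * 'i%C.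
  by apply/eqP; rewrite eq_complex /= !mulr0 !mul0r !mulr1 subr0 addr0 !eqxx.
rewrite rmorphM rmorphMn rmorphM fmorphV !rmorph_nat.
by ring.
Qed.

Lemma cexp_im (b : R) : cexp (0 +i* b) = cos b +i* sin b.
Proof. by rewrite /cexp /= expR0 mul1r. Qed.

Lemma zroot_unity (n : nat) : (0 < n)%N -> zroot n ^+ n = 1.
Proof.
move=> n0; rewrite /zroot -cexpMn zroot_argMn cexp_im.
by rewrite divff ?pnatr_eq0 -?lt0n // mulr1 cos2pi sin2pi.
Qed.

(** Half-angle argument: with theta = pi k / n strictly between 0 and pi, the real part is cos(2
    theta) = 1 - 2 sin(theta)^2 < 1. *)
Lemma zroot_neq1 (n k : nat) : (0 < k < n)%N -> zroot n ^+ k != 1.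
Proof.
case/andP=> k0 kn; have n0 : (0 < n)%N by apply: ltn_trans kn.
rewrite /zroot -cexpMn zroot_argMn cexp_im [pi *+ 2 * _]mulrnAl.
have : 0 < sin (pi * (k%:R / n%:R) : R).
  apply: sin_gt0_pi; apply/andP; split.
    by rewrite mulr_gt0 ?pi_gt0 ?divr_gt0 ?ltr0n.
  by rewrite gtr_pMr ?pi_gt0 // ltr_pdivrMr ?ltr0n // mul1r ltr_nat.
move=> s0; apply/eqP => -[+ _]; apply/eqP; rewrite cos_mulr2n cos2sin2.
by rewrite lt_eqF // ltrBlDr -mulr2n ltrMn2r /= ltrBlDr ltrDl exprn_gt0.
Qed.

End RootsOfUnity.

Section PairingOfProducts.
Set Implicit Arguments.
Unset Strict Implicit.
Local Open Scope ring_scope.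
Import GRing.Theory.
Variables (R : realType) (I : finType) (s : I -> nat).
Hypothesis s_gt0 : forall i, (0 < s i)%N.
Implicit Types m x y b : prodZ s.

(** Natural-number exponents make the character visibly symmetric in [m] and [x]; an arbitrary
    finite index type lets it serve both [G] and [G_I]. *)
Definition pairing m x : R[i] :=
  \prod_i zroot R (s i) ^+ (val (m i) * val (x i)).

Lemma pairingC m x : pairing m x = pairing x m.
Proof. by apply: eq_bigr => i _; rewrite mulnC. Qed.

Lemma pairing0r m : pairing m 0 = 1.
Proof. by rewrite /pairing big1 // => i _; rewrite ffunE muln0. Qed.

Lemma pairingDr m x y : pairing m (x + y) = pairing m x * pairing m y.
Proof.
rewrite /pairing -big_split; apply: eq_bigr => i _ /=.
have w1 : zroot R (s i) ^+ (s i).-1.+1 = 1 by rewrite prednK // zroot_unity.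
(* Addition in [cyc (s i)] reduces modulo [(s i).-1.+1], which is harmless in an exponent by
   [w1]. *)
rewrite ffunE /= -exprD -mulnDr exprM expr_mod -exprM //.
by rewrite mulnC exprM w1 expr1n.
Qed.

Lemma exists_pairing_neq1 m : m != 0 -> exists x, pairing m x != 1.
Proof.
move=> m0; have [i mi0] : exists i, m i != 0.
  apply/existsP; apply: contraR m0; rewrite negb_exists => /forallP m0.
  by apply/eqP/ffunP => i; rewrite ffunE; apply/eqP; move: (m0 i); rewrite negbK.
have mi_gt0 : (0 < m i)%N.
  by rewrite lt0n; apply: contraNneq mi0 => mi0; apply/eqP/val_inj.
have mi_lt : (m i < s i)%N by apply: leq_trans (ltn_ord (m i)) _; rewrite prednK.
(* The unit vector at [i]: the value 1 is in range there because [0 < m i < s i] forces [s i] to be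
   at least 2. *)
pose y : prodZ s := [ffun j => inord (j == i) : cyc (s j)].
have yE j : val (y j) = (j == i).
  rewrite ffunE /= inordK //; case: eqP => // ->.
  by rewrite prednK //; apply: leq_trans mi_lt.
exists y; rewrite /pairing (bigD1 i) //= yE eqxx muln1 big1 ?mulr1.
  by rewrite zroot_neq1 // mi_gt0.
by move=> j /negPf ji; rewrite yE ji muln0.
Qed.

(** Translating by some [y] with [pairing m y != 1] permutes the terms, yet multiplies the sum by
    [pairing m y]. *)
Lemma sum_pairing m : m != 0 -> \sum_x pairing m x = 0.
Proof.
case/exists_pairing_neq1 => y my.
have : (1 - pairing m y) * (\sum_x pairing m x) = 0.
  rewrite mulrBl mul1r [X in X - _](reindex_inj (addrI y)) /=.
  by under eq_bigr do rewrite pairingDr; rewrite -big_distrr subrr.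
by move/eqP; rewrite mulf_eq0 subr_eq0 eq_sym (negPf my) => /eqP.
Qed.

(** By symmetry of the pairing, summing over characters is again a sum over group elements, so
    [sum_pairing] applies. *)
Lemma sum_pairingB b x :
  \sum_m pairing m (x - b) = (if x == b then #|prodZ s| else 0)%:R.
Proof.
case: eqVneq => [->|xb].
  by rewrite subrr; under eq_bigr do rewrite pairing0r; rewrite sumr_const.
by under eq_bigr do rewrite pairingC; rewrite sum_pairing // subr_eq0.
Qed.

End PairingOfProducts.

Section Extension.
Set Implicit Arguments.
Unset Strict Implicit.
Local Open Scope ring_scope.
Import GRing.Theory.
Variables (R : realType) (k : nat) (s : 'I_k -> nat) (I : {set 'I_k}).
Implicit Types (m x : prodZ s) (b : prodZ (@restr_levels k s I)).

(** Extension by zero. Matching on [boolP] supplies the membership proof needed to index [b]. *)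
Definition ext b : prodZ s :=
  [ffun i => match boolP (i \in I) with
             | AltTrue h => b (exist _ i h)
             | AltFalse _ => 0 : cyc (s i)
             end].

Lemma extK b : proj I (ext b) = b.
Proof.
apply/ffunP => -[i iI]; rewrite !ffunE /=; case: {-}_ / boolP => [h|/negP//].
by rewrite (bool_irrelevance h iI).
Qed.

Lemma supp_ext b : supp (ext b) \subset I.
Proof.
apply/subsetP => i; rewrite inE ffunE.
by case: {-}_ / boolP => // _; rewrite eqxx.
Qed.

Lemma chiE m x : chi R m x = pairing R m x.
Proof.
apply: eq_bigr => j _; rewrite /zroot -cexpMn; congr cexp.
rewrite -[RHS]mulr_natr natrM -!mulrA; do 3!congr (_ * _).
by rewrite mulrA mulrC.
Qed.

(** Coordinates outside [I] contribute a zeroth power, that is, a factor 1. *)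
Lemma chi_proj m x : supp m \subset I ->
  chi R m x = pairing R (proj I m) (proj I x).
Proof.
move=> /subsetP mI; rewrite chiE /pairing.
rewrite [LHS](bigID (mem I)) /= [X in _ * X]big1 ?mulr1.
  by rewrite big_sub; apply: eq_bigr => i _; rewrite !ffunE.
move=> j jI; have : j \notin supp m by apply: contra jI; apply: mI.
by rewrite inE negbK => /eqP->; rewrite mul0n.
Qed.

End Extension.

Lemma sum_count (V : nmodType) (T : Type) (J : finType) (r : seq T)
    (h : T -> J) (F : J -> V) :
  (\sum_(x <- r) F (h x) = \sum_j F j *+ count (fun x => h x == j) r)%R.
Proof.
rewrite (partition_big h xpredT) //=; apply: eq_bigr => j _.
rewrite (eq_bigr (fun=> F j)) => [|x /eqP->//].
by rewrite big_const_seq GRing.iter_addr_0.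
Qed.

Lemma superset_of_card (T : finType) (B : {set T}) (n : nat) :
  #|B| <= n <= #|T| -> exists2 C : {set T}, B \subset C & #|C| = n.
Proof.
case/andP; elim: n => [|n IHn] Bn nT.
  by exists B => //; apply/eqP; rewrite -leqn0.
move: Bn; rewrite leq_eqVlt => /predU1P[BSn|Bn]; first by exists B.
have [C BC Cn] := IHn Bn (ltnW nT).
have /set0Pn[x] : ~: C != set0.
  by rewrite -card_gt0 -(ltn_add2l #|C|) addn0 cardsC Cn.
rewrite inE => xC; exists (x |: C); first by rewrite (subset_trans BC) ?subsetUr.
by rewrite cardsU1 xC Cn.
Qed.

Theorem lemma2p4 (R : realType) (k t : nat) (s : 'I_k -> nat)
    (A : {mset prodZ s}%mset) :
  1 <= t <= k ->
  (forall j : 'I_k, 0 < s j) ->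
  A <> mset0 ->
  is_OA (size A) t A <->
  (forall m : prodZ s, m <> 0%R -> #|supp m| <= t ->
     (\sum_(x <- A) chi R m x)%R = 0%R).
Proof.
move=> /andP[_ tk] s0 /eqP A0.
have sI0 (I : {set 'I_k}) i : 0 < @restr_levels k s I i by exact: s0.
split=> [[_ OA] m m0 mt|chi0].
  (* The array condition concerns sets of exactly [t] coordinates, so a smaller support is first
     enlarged. *)
  have [I mI It] : exists2 I : {set 'I_k}, supp m \subset I & #|I| = t.
    by apply: superset_of_card; rewrite mt card_ord.
  have [l _ lE] := OA I It.
  have pm0 : proj I m != 0%R.
    apply: contra_notN m0 => /eqP/ffunP pm0; apply/ffunP => i; rewrite ffunE.
    have [iI|iI] := boolP (i \in I).
      by have := pm0 (exist _ i iI); rewrite !ffunE.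
    have : i \notin supp m by apply: contra iI; apply: (subsetP mI).
    by rewrite inE negbK => /eqP.
  under eq_bigr do rewrite (chi_proj R _ mI).
  rewrite sum_count; under eq_bigr do rewrite lE.
  by rewrite GRing.sumrMnl sum_pairing // GRing.mul0rn.
split=> // I It; set G := prodZ (@restr_levels k s I).
have cE b : #|{: G}| * count (fun a => proj I a == b) A = size A.
  apply/eqP; rewrite -(Num.Theory.eqr_nat R[i]); apply/eqP.
  (* Double counting: the inner sum detects [proj I a = b], while after exchanging the sums the term
     [m = 0] alone yields [size A]. *)
  transitivity (\sum_(a <- A) \sum_(m : G) pairing R m (proj I a - b))%R.
    rewrite (sum_count _ _ (fun y => \sum_(m : G) pairing R m (y - b)))%R.
    under eq_bigr do rewrite sum_pairingB //.
    rewrite (bigD1 b) //= eqxx big1 => [|j /negPf->]; last by rewrite GRing.mul0rn.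
    by rewrite GRing.addr0 GRing.natrM GRing.mulr_natr.
  rewrite exchange_big (bigD1 0%R) //= [X in (_ + X)%R]big1 => [|m m0].
    rewrite GRing.addr0; under eq_bigr do rewrite pairingC pairing0r.
    by rewrite big_const_seq count_predT GRing.iter_addr_0.
  (* The factor at [- b] does not depend on the row; the other one is the character of [ext m], to
     which [chi0] applies. *)
  under eq_bigr do rewrite pairingDr // -{1}(extK m) -chi_proj ?supp_ext //.
  rewrite -GRing.mulr_suml chi0 ?GRing.mul0r //.
    apply: contra_neq_not m0 => m0; rewrite -(extK m) m0.
    by apply/ffunP => i; rewrite !ffunE.
  by rewrite -It subset_leq_card ?supp_ext.
have G0 : 0 < #|{: G}| by apply/card_gt0P; exists 0%R.
exists (size A %/ #|{: G}|); last by move=> b; rewrite -(cE b) mulKn.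
(* Nonemptiness of [A] makes the common multiplicity positive, as seen from [cE] at [b = 0]. *)
have : 0 < size A by rewrite lt0n size_mset_eq0.
by rewrite -(cE 0%R) mulKn // muln_gt0 G0.
Qed.
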